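(* Let $N$ be a positive integer that is not a perfect square, with continued fraction expansion $\sqrt N=[a_0;\overline{a_1,a_2,\ldots,a_{\tau-1},2a_0}]$ of (minimal) period length $\tau$, and let $\Omega_m=A_mA_{m-1}-NB_mB_{m-1}$ as in the context. Then the sequence $(\Omega_m)_{m\ge1}$ is periodic with period $\tau$ if $\tau$ is even and with period $2\tau$ if $\tau$ is odd. Moreover, $\Omega_{\tau-m-1}=(-1)^{\tau+1}\Omega_m$ for all $1\le m\le\tau-2$.
   Context: $a_0=\lfloor\sqrt N\rfloor$ and $(a_m)_{m\ge 0}$ are the partial quotients of $\sqrt N$. The convergents are defined by $A_{-1}=1$, $B_{-1}=0$, $A_0=a_0$, $B_0=1$, and for $m\ge1$: $A_m=a_mA_{m-1}+A_{m-2}$, $B_m=a_mB_{m-1}+B_{m-2}$. For $m\ge0$, $\Omega_m=A_mA_{m-1}-NB_mB_{m-1}$. *)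

(* Defs.v *)
From Stdlib Require Import Reals ZArith Arith.
Open Scope Z_scope.

(* [Int_part] is the floor function. *)
Fixpoint complete_quotient (x : R) (m : nat) : R :=
  match m with
  | O => x
  | S m' => let y := complete_quotient x m' in (/ (y - IZR (Int_part y)))%R
  end.

Definition partial_quotient (x : R) (m : nat) : Z :=
  Int_part (complete_quotient x m).

(* Indices are shifted by one, so that A_{-1} and B_{-1} exist:
   [cvg_num a k] is A_{k-1} and [cvg_den a k] is B_{k-1}. *)
Fixpoint cvg_num (a : nat -> Z) (k : nat) : Z :=
  match k with
  | O => 1
  | S m => match m with
           | O => a O
           | S j => a m * cvg_num a m + cvg_num a j
           end
  end.

Fixpoint cvg_den (a : nat -> Z) (k : nat) : Z :=
  match k with
  | O => 0
  | S m => match m with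
           | O => 1
           | S j => a m * cvg_den a m + cvg_den a j
           end
  end.

Definition sqrt_pq (N : Z) : nat -> Z := partial_quotient (sqrt (IZR N)).

(* Omega_m = A_m A_{m-1} - N B_m B_{m-1} *)
Definition Omega (N : Z) (m : nat) : Z :=
  cvg_num (sqrt_pq N) (S m) * cvg_num (sqrt_pq N) m
  - N * (cvg_den (sqrt_pq N) (S m) * cvg_den (sqrt_pq N) m).

(* T is a (not necessarily minimal) period of (u_m)_{m >= 1}. *)
Definition is_period (u : nat -> Z) (T : nat) : Prop :=
  (1 <= T)%nat /\ forall m : nat, (1 <= m)%nat -> u (m + T)%nat = u m.

Definition is_minimal_period (u : nat -> Z) (T : nat) : Prop :=
  is_period u T /\ forall T' : nat, is_period u T' -> (T <= T')%nat.

(* sqrt N = [a_0; a_1, ..., a_{tau-1}, 2 a_0, a_1, ...], tau minimal *)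
Definition sqrt_cf_expansion (N : Z) (tau : nat) : Prop :=
  is_minimal_period (sqrt_pq N) tau /\ sqrt_pq N tau = 2 * sqrt_pq N O.

(* Main.v *)
Require Import Defs.
From Stdlib Require Import Reals ZArith Arith Lra Lia Psatz.
Open Scope Z_scope.

(** Write the complete quotients of [sqrt N] as [(P_m + sqrt N) / Q_m].  An
    induction gives [Omega_m = (-1)^m P_{m+1}].  A nonterminating expansion
    determines its value, so the period of the partial quotients is one of the
    [P_m] and [Q_m], [m >= 1]; together with [a_tau = 2 a_0] it forces
    [P_tau = a_0 = P_1] and [Q_tau = 1 = Q_0].  For [m >= 1] the quotients are
    reduced, so [a_m] is also the floor of [(P_{m+1} + sqrt N) / Q_m]: the
    recurrence runs backwards by the same rule, whence [P_{tau-j} = P_{j+1}]. *)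

(** * Characterization of the floor *)

Lemma Int_part_bounds (x : R) :
  (IZR (Int_part x) <= x < IZR (Int_part x) + 1)%R.
Proof. destruct (base_Int_part x); lra. Qed.

Lemma Int_part_unique (x : R) (z : Z) :
  (IZR z <= x < IZR z + 1)%R -> Int_part x = z.
Proof.
  intros H; pose proof (Int_part_bounds x) as H'.
  assert (H1 : (IZR z < IZR (Int_part x + 1))%R) by (rewrite plus_IZR; lra).
  assert (H2 : (IZR (Int_part x) < IZR (z + 1))%R) by (rewrite plus_IZR; lra).
  apply lt_IZR in H1; apply lt_IZR in H2; lia.
Qed.

(** * Continued fractions determine their value *)

(** No complete quotient is an integer, so the recursion never inverts 0. *)
Definition nonterminating (x : R) : Prop :=
  forall n : nat, (IZR (partial_quotient x n) < complete_quotient x n)%R.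

Lemma complete_quotient_add (x : R) (m n : nat) :
  complete_quotient x (n + m) = complete_quotient (complete_quotient x m) n.
Proof. induction n as [|n IH]; simpl; [|rewrite IH]; reflexivity. Qed.

Lemma partial_quotient_add (x : R) (m n : nat) :
  partial_quotient x (n + m) = partial_quotient (complete_quotient x m) n.
Proof. unfold partial_quotient; now rewrite complete_quotient_add. Qed.

Lemma nonterminating_complete_quotient (x : R) (m : nat) :
  nonterminating x -> nonterminating (complete_quotient x m).
Proof.
  intros H n; rewrite <- partial_quotient_add, <- complete_quotient_add; apply H.
Qed.

Lemma complete_quotient_S (x : R) (n : nat) :
  nonterminating x ->
  (1 < complete_quotient x (S n) /\
   (complete_quotient x n - IZR (partial_quotient x n)) *
     complete_quotient x (S n) = 1)%R.
Proof.
  intros H; specialize (H n); unfold partial_quotient in *; simpl.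
  pose proof (Int_part_bounds (complete_quotient x n)).
  split; [|field; lra].
  rewrite <- Rinv_1; apply Rinv_lt_contravar; lra.
Qed.

(* Two steps contract by 4: [x_1 x_2 = a_1 x_2 + 1 > 2]. *)
Lemma same_partial_quotients_close (n : nat) : forall x y : R,
  nonterminating x -> nonterminating y ->
  (forall k, partial_quotient x k = partial_quotient y k) ->
  (Rabs (x - y) <= (/ 4) ^ n)%R.
Proof.
  induction n as [|n IH]; intros x y Hx Hy E.
  - pose proof (Int_part_bounds x); pose proof (Int_part_bounds y).
    specialize (E O); unfold partial_quotient in E; simpl in E; rewrite E in *.
    simpl; apply Rabs_le; lra.
  - assert (H2 : (Rabs (complete_quotient x 2 - complete_quotient y 2)
                  <= (/ 4) ^ n)%R).
    { apply IH; try now apply nonterminating_complete_quotient.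
      intros k; rewrite <- !partial_quotient_add; apply E. }
    destruct (complete_quotient_S x 0 Hx) as [gx1 ex1].
    destruct (complete_quotient_S x 1 Hx) as [gx2 ex2].
    destruct (complete_quotient_S y 0 Hy) as [gy1 ey1].
    destruct (complete_quotient_S y 1 Hy) as [gy2 ey2].
    rewrite <- E in ey1; rewrite <- E in ey2.
    assert (Ha : (1 <= IZR (partial_quotient x 1))%R).
    { apply IZR_le.
      pose proof (Int_part_bounds (complete_quotient x 1)) as B.
      assert (L : (IZR 0 < IZR (partial_quotient x 1))%R)
        by (unfold partial_quotient; lra).
      apply lt_IZR in L; lia. }
    change (complete_quotient x 0) with x in *.
    change (complete_quotient y 0) with y in *.
    revert H2 gx1 ex1 gx2 ex2 gy1 ey1 gy2 ey2 Ha.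
    generalize (complete_quotient x 1), (complete_quotient x 2),
      (complete_quotient y 1), (complete_quotient y 2),
      (IZR (partial_quotient x 0)), (IZR (partial_quotient x 1)).
    intros x1 x2 y1 y2 a b H2 gx1 ex1 gx2 ex2 gy1 ey1 gy2 ey2 Hb.
    assert (X : (2 < x1 * x2)%R) by nra.
    assert (Y : (2 < y1 * y2)%R) by nra.
    (* The common partial quotient cancels in [x - y], leaving [1/x1 - 1/y1] with denominators
       cleared; [D2] does the same one level down. *)
    assert (D1 : ((x - y) * (x1 * y1) = y1 - x1)%R).
    { replace ((x - y) * (x1 * y1))%R
        with (((x - a) * x1) * y1 - ((y - a) * y1) * x1)%R by ring.
      rewrite ex1, ey1; ring. }
    assert (D2 : ((y1 - x1) * (x2 * y2) = x2 - y2)%R).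
    { replace ((y1 - x1) * (x2 * y2))%R
        with (((y1 - b) * y2) * x2 - ((x1 - b) * x2) * y2)%R by ring.
      rewrite ex2, ey2; ring. }
    assert (D : ((x - y) * ((x1 * x2) * (y1 * y2)) = x2 - y2)%R)
      by (rewrite <- D2, <- D1; ring).
    rewrite <- D, Rabs_mult in H2.
    assert (P : (4 <= (x1 * x2) * (y1 * y2))%R) by nra.
    rewrite (Rabs_pos_eq ((x1 * x2) * (y1 * y2))) in H2 by lra.
    pose proof (Rabs_pos (x - y)); simpl; nra.
Qed.

(** The distance lies below every power of 1/4, hence is 0. *)
Lemma same_partial_quotients_eq (x y : R) :
  nonterminating x -> nonterminating y ->
  (forall k, partial_quotient x k = partial_quotient y k) -> x = y.
Proof.
  intros Hx Hy E.
  destruct (Req_dec x y) as [|ne]; [assumption|exfalso].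
  assert (p : (0 < Rabs (x - y))%R) by (apply Rabs_pos_lt; lra).
  destruct (pow_lt_1_zero (/ 4)) with (y := Rabs (x - y)) as [n Hn].
  - rewrite Rabs_pos_eq; lra.
  - lra.
  - specialize (Hn n (le_n n)).
    rewrite Rabs_pos_eq in Hn by (apply pow_le; lra).
    pose proof (same_partial_quotients_close n x y Hx Hy E); lra.
Qed.

(** * Complete quotients of a quadratic surd *)

(** After division by the gcd, the reduced denominator divides the square of a numerator coprime to
    it, so by Gauss it divides the numerator. *)
Lemma square_of_square_ratio (N a b : Z) :
  b <> 0 -> a * a = N * (b * b) -> exists k, N = k * k.
Proof.
  intros Hb E.
  set (g := Z.gcd a b).
  assert (Hg : g <> 0) by (intros G; apply Z.gcd_eq_0_r in G; auto).
  destruct (Z.gcd_divide_l a b) as [a' Ea]; fold g in Ea.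
  destruct (Z.gcd_divide_r a b) as [b' Eb]; fold g in Eb.
  assert (C : Z.gcd a' b' = 1).
  { pose proof (Z.gcd_div_gcd a b g Hg eq_refl) as C.
    rewrite Ea, Eb, !Z.div_mul in C by assumption; exact C. }
  assert (E' : a' * a' = N * (b' * b')).
  { apply Z.mul_reg_r with (p := g * g); [nia|].
    rewrite Ea, Eb in E; nia. }
  assert (D : (b' | a')).
  { apply Z.gauss with (m := a'); [|now rewrite Z.gcd_comm].
    exists (N * b'); rewrite E'; ring. }
  destruct D as [c Ec].
  exists c.
  assert (b' <> 0) by (intros Z0; apply Hb; rewrite Eb, Z0; reflexivity).
  apply Z.mul_reg_r with (p := b' * b'); [nia|].
  rewrite <- E', Ec; ring.
Qed.

(** The pair of integers in [(P + sqrt N) / Q]. The integer division is exact, as [surd_invariant]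
    shows. *)
Fixpoint surd_PQ (N : Z) (m : nat) : Z * Z :=
  match m with
  | O => (0, 1)
  | S m' => let (P, Q) := surd_PQ N m' in
            let P' := sqrt_pq N m' * Q - P in (P', (N - P' * P') / Q)
  end.

Definition surd_P (N : Z) (m : nat) : Z := fst (surd_PQ N m).
Definition surd_Q (N : Z) (m : nat) : Z := snd (surd_PQ N m).

Lemma surd_P_S (N : Z) (m : nat) :
  surd_P N (S m) = sqrt_pq N m * surd_Q N m - surd_P N m.
Proof. unfold surd_P, surd_Q; simpl; now destruct (surd_PQ N m). Qed.

Lemma surd_Q_S (N : Z) (m : nat) :
  surd_Q N (S m) = (N - surd_P N (S m) * surd_P N (S m)) / surd_Q N m.
Proof. unfold surd_P, surd_Q; simpl; now destruct (surd_PQ N m). Qed.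

Section SqrtContinuedFraction.

Variable N : Z.
Hypothesis N_pos : 0 < N.
Hypothesis N_nonsquare : ~ exists k : Z, N = k * k.

Let s := sqrt (IZR N).
Let a := sqrt_pq N.
Let P := surd_P N.
Let Q := surd_Q N.

Lemma sqrt_mul_self : (s * s = IZR N)%R.
Proof. apply sqrt_sqrt, IZR_le; lia. Qed.

Lemma sqrt_ge_1 : (1 <= s)%R.
Proof.
  unfold s; rewrite <- sqrt_1; apply sqrt_le_1_alt, IZR_le; lia.
Qed.

Lemma sqrt_irrational (p q : Z) : (s * IZR q = IZR p)%R -> q = 0.
Proof.
  intros E; destruct (Z.eq_dec q 0) as [|nz]; [assumption|exfalso].
  apply N_nonsquare, (square_of_square_ratio N p q nz).
  apply eq_IZR; rewrite !mult_IZR, <- E, <- sqrt_mul_self; ring.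
Qed.

(** Induction step. The premise asks only for [Q <= P + s], which holds at index 0, where [P = 0]
    and [Q = 1], and still yields [1 <= a m]. The conclusion is full reducedness, which starts at
    index 1. *)
Lemma surd_invariant (m : nat) :
  0 < Q m /\ (IZR (P m) < s)%R /\ (IZR (Q m) <= IZR (P m) + s)%R /\
  (Q m | N - P m * P m) /\
  complete_quotient s m = ((IZR (P m) + s) / IZR (Q m))%R ->
  (IZR (a m) < complete_quotient s m)%R /\ 1 <= a m /\
  Q (S m) * Q m = N - P (S m) * P (S m) /\
  (s - IZR (P (S m)) < IZR (Q (S m)) < IZR (P (S m)) + s)%R /\
  0 < Q (S m) /\ (IZR (P (S m)) < s)%R /\
  complete_quotient s (S m) = ((IZR (P (S m)) + s) / IZR (Q (S m)))%R.
Proof.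
  intros (Qpos & Plt & Qle & [d Ed] & Eq).
  pose proof (IZR_lt _ _ Qpos) as QposR.
  pose proof (Int_part_bounds (complete_quotient s m)) as B.
  change (Int_part (complete_quotient s m)) with (a m) in B.
  assert (EqM : (complete_quotient s m * IZR (Q m) = IZR (P m) + s)%R)
    by (rewrite Eq; field; lra).
  assert (EP : P (S m) = a m * Q m - P m) by apply surd_P_S.
  assert (EPR : (IZR (P (S m)) = IZR (a m) * IZR (Q m) - IZR (P m))%R)
    by (rewrite EP, minus_IZR, mult_IZR; reflexivity).
  assert (alt : (IZR (a m) < complete_quotient s m)%R).
  { destruct B as [[lt|E] _]; [assumption|exfalso].
    (* Equality would make [s] the integer [P (S m)]; irrationality is applied with denominator
       1. *)
    assert (1 = 0); [|lia].
    apply (sqrt_irrational (P (S m))); rewrite EPR.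
    rewrite <- E in EqM; lra. }
  assert (apos : 1 <= a m).
  { assert (L : (IZR 0 < IZR (a m))%R).
    { assert (1 <= complete_quotient s m)%R; [|lra].
      apply Rmult_le_reg_r with (IZR (Q m)); lra. }
    apply lt_IZR in L; lia. }
  assert (aposR : (1 <= IZR (a m))%R) by (apply IZR_le; lia).
  assert (EQ : Q (S m) * Q m = N - P (S m) * P (S m)).
  { unfold Q; rewrite surd_Q_S; fold P Q; rewrite Z.mul_comm.
    symmetry; apply Z_div_exact_full_2; [lia|].
    apply Z.mod_divide; [lia|].
    (* The cofactor of [Q m] when [N - (a m * Q m - P m)^2] is expanded with
       [N - (P m)^2 = d * Q m]. *)
    exists (d - a m * a m * Q m + 2 * a m * P m).
    rewrite EP; nia. }
  assert (EQR : (IZR (Q (S m)) * IZR (Q m)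
                 = (s - IZR (P (S m))) * (s + IZR (P (S m))))%R).
  { rewrite <- mult_IZR, EQ, minus_IZR, mult_IZR, <- sqrt_mul_self; ring. }
  assert (Plt' : (IZR (P (S m)) < s)%R) by (rewrite EPR; nra).
  (* Through the factorization [EQR], these two bounds on [Q m] become the lower and upper bounds on
     [Q (S m)]. *)
  assert (H1 : (IZR (Q m) < s + IZR (P (S m)))%R) by (rewrite EPR; nra).
  assert (H2 : (s - IZR (P (S m)) < IZR (Q m))%R) by (rewrite EPR; nra).
  assert (Qpos' : (0 < IZR (Q (S m)))%R).
  { apply Rmult_lt_reg_r with (IZR (Q m)); [assumption|].
    rewrite EQR, Rmult_0_l; apply Rmult_lt_0_compat; lra. }
  repeat split; try assumption.
  - apply Rmult_lt_reg_r with (IZR (Q m)); [assumption|]; rewrite EQR; nra.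
  - apply Rmult_lt_reg_r with (IZR (Q m)); [assumption|]; rewrite EQR; nra.
  - now apply lt_IZR.
  - simpl; change (Int_part (complete_quotient s m)) with (a m).
    assert (E : ((complete_quotient s m - IZR (a m)) * IZR (Q m)
                 = s - IZR (P (S m)))%R) by (rewrite EPR; lra).
    assert (complete_quotient s m - IZR (a m) <> 0)%R by lra.
    apply Rmult_eq_reg_l with (complete_quotient s m - IZR (a m))%R;
      [|assumption].
    rewrite Rinv_r by assumption.
    apply Rmult_eq_reg_r with (IZR (Q (S m)) * IZR (Q m))%R; [|nra].
    transitivity (((complete_quotient s m - IZR (a m)) * IZR (Q m))
                  * (IZR (P (S m)) + s))%R; [|field; lra].
    rewrite E, EQR; ring.
Qed.

Lemma surd_invariant_all (m : nat) :
  0 < Q m /\ (IZR (P m) < s)%R /\ (IZR (Q m) <= IZR (P m) + s)%R /\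
  (Q m | N - P m * P m) /\
  complete_quotient s m = ((IZR (P m) + s) / IZR (Q m))%R.
Proof.
  induction m as [|m IH].
  - pose proof sqrt_ge_1; unfold P, Q, surd_P, surd_Q; simpl.
    repeat split; try lia; try lra.
    apply Z.divide_1_l.
  - destruct (surd_invariant m IH) as (_ & _ & E & ? & ? & ? & ?).
    repeat split; try assumption; try lra.
    exists (Q m); rewrite <- E; ring.
Qed.

Lemma surd_Q_pos (m : nat) : 0 < Q m.
Proof. apply surd_invariant_all. Qed.

Lemma complete_quotient_surd (m : nat) :
  complete_quotient s m = ((IZR (P m) + s) / IZR (Q m))%R.
Proof. apply surd_invariant_all. Qed.

Lemma surd_Q_mul (m : nat) : Q (S m) * Q m = N - P (S m) * P (S m).
Proof. apply surd_invariant, surd_invariant_all. Qed.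

Lemma surd_reduced (m : nat) :
  (IZR (P (S m)) < s /\
   s - IZR (P (S m)) < IZR (Q (S m)) < IZR (P (S m)) + s)%R.
Proof.
  destruct (surd_invariant m (surd_invariant_all m)) as (_ & _ & _ & ? & _ & ? & _).
  auto.
Qed.

Lemma sqrt_nonterminating : nonterminating s.
Proof. intros m; apply (surd_invariant m (surd_invariant_all m)). Qed.

(** A recurrence free of division, as the norm induction needs: expand [N - P^2] at the new index
    and cancel [Q (S m)]. *)
Lemma surd_Q_SS (m : nat) :
  Q (S (S m)) = Q m - a (S m) * a (S m) * Q (S m) + 2 * a (S m) * P (S m).
Proof.
  pose proof (surd_Q_pos (S m)).
  pose proof (surd_Q_mul m) as E1; pose proof (surd_Q_mul (S m)) as E2.
  assert (E : P (S (S m)) = a (S m) * Q (S m) - P (S m)) by apply surd_P_S.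
  apply Z.mul_reg_r with (p := Q (S m)); [lia|].
  rewrite E2, E; nia.
Qed.

(** Clear denominators and compare the coefficients of 1 and of the irrational [s]. *)
Lemma surd_unique (m n : nat) :
  complete_quotient s m = complete_quotient s n -> P m = P n /\ Q m = Q n.
Proof.
  rewrite !complete_quotient_surd; intros E.
  pose proof (IZR_lt _ _ (surd_Q_pos m)) as Hm.
  pose proof (IZR_lt _ _ (surd_Q_pos n)) as Hn.
  assert (E' : ((IZR (P m) + s) * IZR (Q n) = (IZR (P n) + s) * IZR (Q m))%R).
  { apply Rmult_eq_reg_r with (/ IZR (Q m) * / IZR (Q n))%R.
    - transitivity ((IZR (P m) + s) / IZR (Q m))%R; [field; lra|].
      rewrite E; field; lra.
    - apply Rgt_not_eq, Rmult_lt_0_compat; apply Rinv_0_lt_compat; lra. }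
  assert (EQ : Q n - Q m = 0).
  { apply (sqrt_irrational (P n * Q m - P m * Q n)).
    rewrite !minus_IZR, !mult_IZR; lra. }
  assert (EQ' : Q m = Q n) by lia.
  split; [|assumption].
  apply eq_IZR; rewrite EQ' in E'.
  apply Rmult_eq_reg_r in E'; lra.
Qed.

(* Reducedness puts [(s - P_m) / Q_m] in [[0, 1)], so adding it to [a_m] leaves
   the floor unchanged. *)
Lemma sqrt_pq_backward (m : nat) :
  a (S m) = Int_part ((IZR (P (S (S m))) + s) / IZR (Q (S m))).
Proof.
  symmetry; apply Int_part_unique.
  destruct (surd_reduced m) as (L & M & _).
  pose proof (IZR_lt _ _ (surd_Q_pos (S m))) as Hq.
  assert (E : (IZR (P (S (S m)))
               = IZR (a (S m)) * IZR (Q (S m)) - IZR (P (S m)))%R).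
  { rewrite <- mult_IZR, <- minus_IZR; f_equal; apply surd_P_S. }
  rewrite E.
  replace ((IZR (a (S m)) * IZR (Q (S m)) - IZR (P (S m)) + s) / IZR (Q (S m)))%R
    with (IZR (a (S m)) + (s - IZR (P (S m))) / IZR (Q (S m)))%R by (field; lra).
  assert (0 <= (s - IZR (P (S m))) / IZR (Q (S m)))%R.
  { apply Rlt_le, Rdiv_lt_0_compat; lra. }
  assert ((s - IZR (P (S m))) / IZR (Q (S m)) < 1)%R.
  { apply Rmult_lt_reg_r with (IZR (Q (S m))); [lra|].
    replace ((s - IZR (P (S m))) / IZR (Q (S m)) * IZR (Q (S m)))%R
      with (s - IZR (P (S m)))%R by (field; lra).
    lra. }
  lra.
Qed.

(** * Omega and the norms of the convergents *)

(** The three claims need a joint induction: by the recurrence of the convergents, the next Omega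
    combines the norm of [A_m + B_m sqrt N] with the current Omega, and the next norm combines Omega
    with the two preceding norms. *)
Lemma Omega_norm_surd (m : nat) :
  Omega N m = (-1) ^ Z.of_nat m * P (S m) /\
  cvg_num a (S m) * cvg_num a (S m) - N * (cvg_den a (S m) * cvg_den a (S m))
    = - (-1) ^ Z.of_nat m * Q (S m) /\
  cvg_num a m * cvg_num a m - N * (cvg_den a m * cvg_den a m)
    = (-1) ^ Z.of_nat m * Q m.
Proof.
  unfold Omega; fold a.
  induction m as [|m (IH1 & IH2 & IH3)].
  - assert (EP : P 1 = a 0%nat * Q 0 - P 0) by apply surd_P_S.
    pose proof (surd_Q_mul 0) as EQ.
    change (Q 0) with 1 in *; change (P 0) with 0 in *.
    simpl cvg_num; simpl cvg_den; simpl Z.of_nat.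
    rewrite Z.pow_0_r; nia.
  - rewrite Nat2Z.inj_succ, Z.pow_succ_r by lia.
    pose proof (surd_Q_SS m) as EQ.
    assert (EP : P (S (S m)) = a (S m) * Q (S m) - P (S m)) by apply surd_P_S.
    assert (EA : cvg_num a (S (S m)) = a (S m) * cvg_num a (S m) + cvg_num a m)
      by reflexivity.
    assert (EB : cvg_den a (S (S m)) = a (S m) * cvg_den a (S m) + cvg_den a m)
      by reflexivity.
    rewrite EA, EB, EP, EQ.
    revert IH1 IH2 IH3.
    generalize ((-1) ^ Z.of_nat m), (cvg_num a (S m)), (cvg_num a m),
      (cvg_den a (S m)), (cvg_den a m), (a (S m)), (P (S m)), (Q (S m)), (Q m).
    intros e A1 A0 B1 B0 c p q q0 H1 H2 H3.
    repeat split.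
    + transitivity (c * (A1 * A1 - N * (B1 * B1)) + (A1 * A0 - N * (B1 * B0)));
        [ring|rewrite H2, H1; ring].
    + transitivity (c * c * (A1 * A1 - N * (B1 * B1))
                    + 2 * c * (A1 * A0 - N * (B1 * B0))
                    + (A0 * A0 - N * (B0 * B0)));
        [ring|rewrite H3, H2, H1; ring].
    + rewrite H2; ring.
Qed.

Lemma Omega_surd (m : nat) : Omega N m = (-1) ^ Z.of_nat m * P (S m).
Proof. apply Omega_norm_surd. Qed.

(** * Periodicity *)

Lemma complete_quotient_period (T : nat) :
  is_period a T -> complete_quotient s (T + 1) = complete_quotient s 1.
Proof.
  intros [_ H].
  apply same_partial_quotients_eq;
    try apply nonterminating_complete_quotient, sqrt_nonterminating.
  intros k; rewrite <- !partial_quotient_add.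
  (* Periodicity starts at index 1, hence the comparison of the tails from 1 and from [T + 1]. *)
  replace (k + (T + 1))%nat with (k + 1 + T)%nat by lia.
  apply H; lia.
Qed.

Lemma surd_P_period (T m : nat) : is_period a T -> P (S m + T) = P (S m).
Proof.
  intros H; apply surd_unique.
  replace (S m + T)%nat with (m + (T + 1))%nat by lia.
  rewrite complete_quotient_add, complete_quotient_period by assumption.
  rewrite <- complete_quotient_add; f_equal; lia.
Qed.

(** [P] repeats after [T] steps, and the sign [(-1)^m] repeats because [T] is even. *)
Lemma Omega_even_period (T : nat) :
  is_period a T -> Nat.Even T -> is_period (Omega N) T.
Proof.
  intros H [k ->]; split; [apply H|intros m _].
  rewrite !Omega_surd.
  replace (S (m + 2 * k)) with (S m + 2 * k)%nat by lia.
  rewrite surd_P_period by assumption.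
  rewrite Nat2Z.inj_add, Nat2Z.inj_mul, Z.pow_add_r, (Z.pow_mul_r (-1)) by lia.
  change ((-1) ^ Z.of_nat 2) with 1; rewrite Z.pow_1_l by lia; ring.
Qed.

(** * Symmetry of the period *)

(** With [x_m] the complete quotients, [x_T = a_T + 1/x_{T+1} = 2 a_0 + 1/x_1 = 2 a_0 + (s - a_0) =
    a_0 + s]; irrationality of [s] then identifies [P T] and [Q T]. *)
Lemma surd_at_period (T : nat) :
  is_period a T -> a T = 2 * a 0%nat -> P T = P 1 /\ Q T = Q 0.
Proof.
  intros H E.
  assert (EP1 : P 1 = a 0%nat).
  { transitivity (a 0%nat * Q 0 - P 0); [apply surd_P_S|].
    change (Q 0) with 1; change (P 0) with 0; ring. }
  pose proof (complete_quotient_S s T sqrt_nonterminating) as [g e].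
  pose proof (complete_quotient_S s 0 sqrt_nonterminating) as [g0 e0].
  pose proof (complete_quotient_period T H) as C; rewrite Nat.add_1_r in C.
  rewrite C in e.
  assert (F : (complete_quotient s T = IZR (a 0%nat) + s)%R).
  { change (partial_quotient s T) with (a T) in e; rewrite E, mult_IZR in e.
    change (partial_quotient s 0) with (a 0%nat) in e0.
    change (complete_quotient s 0) with s in e0.
    apply Rmult_eq_reg_r with (complete_quotient s 1); lra. }
  rewrite complete_quotient_surd in F.
  pose proof (IZR_lt _ _ (surd_Q_pos T)) as Hq.
  assert (F' : (IZR (P T) + s = (IZR (a 0%nat) + s) * IZR (Q T))%R)
    by (rewrite <- F; field; lra).
  assert (EQ : Q T - 1 = 0).
  { apply (sqrt_irrational (P T - a 0%nat * Q T)).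
    rewrite !minus_IZR, mult_IZR; lra. }
  assert (EQ' : Q T = 1) by lia.
  split; [|exact EQ'].
  rewrite EP1; apply eq_IZR; rewrite EQ' in F'; lra.
Qed.

Lemma surd_palindrome (T j : nat) :
  is_period a T -> a T = 2 * a 0%nat -> (j < T)%nat ->
  P (T - j) = P (S j) /\ Q (T - j) = Q j.
Proof.
  intros H E; induction j as [|j IH]; intros L.
  - rewrite Nat.sub_0_r; now apply surd_at_period.
  - destruct IH as [EP EQ]; [lia|].
    (* [T - j - 1] is positive, so the backward formula applies at this index. *)
    destruct (T - S j)%nat as [|k] eqn:Ek; [lia|].
    replace (T - j)%nat with (S (S k)) in * by lia.
    (* Both products of neighbouring [Q] equal [N - P (S j)^2]; cancel the common factor [Q j]. *)
    assert (EQ' : Q (S k) = Q (S j)).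
    { pose proof (surd_Q_mul (S k)) as M1; pose proof (surd_Q_mul j) as M2.
      pose proof (surd_Q_pos j).
      rewrite EP, <- M2, EQ in M1; nia. }
    split; [|exact EQ'].
    (* The backward floor at [S k] is now the forward floor at [S j]. *)
    assert (Ea : a (S k) = a (S j)).
    { rewrite sqrt_pq_backward, EP, EQ'.
      unfold a, sqrt_pq, partial_quotient; fold s.
      now rewrite complete_quotient_surd. }
    assert (E1 : P (S (S k)) = a (S k) * Q (S k) - P (S k)) by apply surd_P_S.
    assert (E2 : P (S (S j)) = a (S j) * Q (S j) - P (S j)) by apply surd_P_S.
    rewrite EP, Ea, EQ' in E1; lia.
Qed.

Lemma Omega_palindrome (T m : nat) :
  is_period a T -> a T = 2 * a 0%nat -> (m < T)%nat ->
  Omega N (T - m - 1) = (-1) ^ Z.of_nat (T + 1) * Omega N m.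
Proof.
  intros H E L.
  destruct (surd_palindrome T m H E L) as [EP _].
  rewrite !Omega_surd.
  replace (S (T - m - 1)) with (T - m)%nat by lia; rewrite EP.
  (* This splitting shows that [(-1)^(T+1) (-1)^m] is [(-1)^(T-m-1)], the two factors [(-1)^m]
     cancelling. *)
  replace (T + 1)%nat with ((T - m - 1) + m + 2)%nat by lia.
  rewrite !Nat2Z.inj_add, !Z.pow_add_r by lia.
  change ((-1) ^ Z.of_nat 2) with 1.
  assert (S2 : (-1) ^ Z.of_nat m * (-1) ^ Z.of_nat m = 1).
  { rewrite <- Z.pow_mul_l; apply Z.pow_1_l; lia. }
  transitivity ((-1) ^ Z.of_nat (T - m - 1)
                * ((-1) ^ Z.of_nat m * (-1) ^ Z.of_nat m) * P (S m));
    [rewrite S2|]; ring.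
Qed.

End SqrtContinuedFraction.

Lemma is_period_double (u : nat -> Z) (T : nat) :
  is_period u T -> is_period u (2 * T).
Proof.
  intros [p H]; split; [lia|intros m L].
  replace (m + 2 * T)%nat with (m + T + T)%nat by lia.
  rewrite !H; lia.
Qed.

Theorem theorem2 (N : Z) (tau : nat)
    (HNpos : 0 < N)
    (HNsq : ~ exists k : Z, N = k * k)
    (Hexp : sqrt_cf_expansion N tau) :
  (Nat.Even tau -> is_period (Omega N) tau) /\
  (Nat.Odd tau -> is_period (Omega N) (2 * tau)) /\
  (forall m : nat, (1 <= m <= tau - 2)%nat ->
     Omega N (tau - m - 1) = (-1) ^ Z.of_nat (tau + 1) * Omega N m).
Proof.
  destruct Hexp as [[Hper _] H2a0].
  split; [|split].
  - now apply Omega_even_period.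
  (* Twice a period of the partial quotients is an even period, so the even case covers this one. *)
  - intros _; apply Omega_even_period; auto; [now apply is_period_double|now exists tau].
  - intros m Hm; apply Omega_palindrome; auto; lia.
Qed.
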